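(* Let $X_1,\dots,X_n$ be smooth manifolds with Borel probability measures $\mu_1,\dots,\mu_n$, let $c:X_1\times\cdots\times X_n\to\mathbb{R}$ be a cost function satisfying the standing assumptions, and let $m\in\mathbb{N}$, $m\ge 1$. Assume that $c$ satisfies the $m$-twist condition on $c$-splitting sets and that $\mu_1$ is non-atomic. Then for each optimal plan $\gamma$ of $(MK)$ with $\mathrm{Supp}(\gamma)\subset D_1(c)$ there exist an integer $k$ with $1\le k\le m$, non-negative measurable real functions $\alpha_1,\dots,\alpha_k$ on $X_1$, and Borel measurable maps $G_1,\dots,G_k:X_1\to X_2\times\cdots\times X_n$ such that $$\gamma=\sum_{i=1}^k\alpha_i\,(\mathrm{Id}\times G_i)_\#\mu_1,$$ where $\sum_{i=1}^k\alpha_i(x)=1$ for $\mu_1$-a.e. $x\in X_1$.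
   Context: Setting. $\Pi(\mu_1,\dots,\mu_n)$ is the set of Borel probability measures on $X_1\times\cdots\times X_n$ whose $X_i$-marginal is $\mu_i$ for each $i$. For $\pi\in\Pi(\mu_1,\dots,\mu_n)$, $I_c(\pi)=\int c\,d\pi$. The Monge–Kantorovich problem $(MK)$ is $\inf\{I_c(\pi):\pi\in\Pi(\mu_1,\dots,\mu_n)\}$, and a minimizer is called an optimal plan. $\mathrm{Supp}(\gamma)$ is the support of $\gamma$. Standing assumptions on $c$. $c: X_1\times\cdots\times X_n\to\mathbb{R}$ is non-negative, lower semi-continuous, differentiable with respect to the first variable at $\mu_1\otimes\cdots\otimes\mu_n$-almost every point, and $I_c(\pi)$ is finite for some $\pi\in\Pi(\mu_1,\dots,\mu_n)$. Moreover, the Kantorovich dual problem admits a solution: there are Borel functions $\varphi_i:X_i\to\mathbb{R}$, $\varphi_i\in L^1(\mu_i)$, such that $\varphi_1$ is differentiable $\mu_1$-a.e., $\varphi_1(x_1)+\cdots+\varphi_n(x_n)\le c(x_1,\dots,x_n)$ for all $(x_1,\dots,x_n)$, and $\int c\,d\gamma=\sum_{i=1}^n\int_{X_i}\varphi_i\,d\mu_i$ for optimal plans $\gamma$. $D_1(c)$ is the set of points of $X_1\times\cdots\times X_n$ at which $c$ is differentiable with respect to the first variable, and $D_{x_1}c$ denotes that derivative. $c$-splitting set. A set $S\subset X_1\times\cdots\times X_n$ is a $c$-splitting set if there exist Borel functions $u_i:X_i\to\mathbb{R}$ such that $\sum_{i=1}^n u_i(x_i)\le c(x_1,\dots,x_n)$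 for all $(x_1,\dots,x_n)$, with equality whenever $(x_1,\dots,x_n)\in S$. $m$-twist condition. $c$ is $m$-twisted on $c$-splitting sets (satisfies the $m$-twist condition on $c$-splitting sets) if for any $c$-splitting set $S$ and any $(\bar x_1,\dots,\bar x_n)\in S\cap D_1(c)$ the set $$\Big\{(\bar x_1,x_2,\dots,x_n)\in S\cap D_1(c):\ D_{x_1}c(\bar x_1,\bar x_2,\dots,\bar x_n)=D_{x_1}c(\bar x_1,x_2,\dots,x_n)\Big\}$$ has cardinality at most $m$. Notation. $\mathrm{Id}\times G_i$ is the map $x\mapsto(x,G_i(x))$, and $\#$ denotes push-forward. The formula $\gamma=\sum_i\alpha_i(\mathrm{Id}\times G_i)_\#\mu_1$ means $\int f\,d\gamma=\sum_i\int_{X_1}\alpha_i(x)f(x,G_i(x))\,d\mu_1(x)$ for every bounded continuous $f:X_1\times\cdots\times X_n\to\mathbb{R}$. *)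

(* Defs.v *)
From HB Require Import structures.
From mathcomp Require Import all_boot all_order all_algebra.
From mathcomp Require Import all_classical all_reals all_analysis.

Set Implicit Arguments.
Unset Strict Implicit.
Unset Printing Implicit Defensive.

Import Order.TTheory GRing.Theory Num.Theory.
Import numFieldNormedType.Exports.

Local Open Scope classical_set_scope.
Local Open Scope card_scope.
Local Open Scope ring_scope.

(* [U] is meant to be open: [continuous] and [differentiable] look at full
   neighborhoods in R^p of the points of [U]. *)
Fixpoint Ck (R : realType) (p q k : nat) (U : set 'rV[R]_p)
    (f : 'rV[R]_p -> 'rV[R]_q) : Prop :=
  match k with
  | 0 => {in U, continuous f}
  | k'.+1 => {in U, forall x, differentiable f x} /\
             forall v, Ck k' U (fun x => 'd f x v)
  end.

Definition smooth_on (R : realType) (p q : nat) (U : set 'rV[R]_p)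
    (f : 'rV[R]_p -> 'rV[R]_q) : Prop :=
  forall k, Ck k U f.

(* Both maps are total: [chart_map] is meaningful on [chart_dom] only, and
   [chart_inv] on [chart_map @` chart_dom] only. *)
Record chart (R : realType) (M : topologicalType) (d : nat) := Chart {
  chart_dom : set M ;
  chart_map :> M -> 'rV[R]_d ;
  chart_inv : 'rV[R]_d -> M ;
  chart_dom_open : open chart_dom ;
  chart_cod_open : open (chart_map @` chart_dom) ;
  chart_mapK : {in chart_dom, cancel chart_map chart_inv} ;
  chart_map_continuous : {in chart_dom, continuous chart_map} ;
  chart_inv_continuous : {in chart_map @` chart_dom, continuous chart_inv}
}.

(* The carrier is pointed because the library's measurable types are; this only
   excludes the empty manifold, which carries no probability measure. *)
Record smooth_manifold (R : realType) := SmoothManifold {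
  carrier :> ptopologicalType ;
  dim : nat ;
  manifold_hausdorff : hausdorff_space carrier ;
  manifold_second_countable : @second_countable carrier ;
  atlas : set (chart R carrier dim) ;
  atlas_cover : \bigcup_(e in atlas) chart_dom e = [set: carrier] ;
  atlas_compat : forall e1 e2, atlas e1 -> atlas e2 ->
    smooth_on (e1 @` (chart_dom e1 `&` chart_dom e2)) (e2 \o chart_inv e1)
}.

Section manifold_derivative.
Variables (R : realType) (M : smooth_manifold R).
Implicit Types (f : M -> R) (x : M).

Definition chart_at x (e : chart R M (dim M)) : Prop :=
  atlas e /\ chart_dom e x.

Definition mdifferentiable f x : Prop :=
  forall e, chart_at x e ->
    differentiable (f \o chart_inv e : 'rV[R]_(dim M) -> R) (e x).

(* The derivative of [f] at [x] as a covariant vector: the family of its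
   coordinate expressions, linear forms on R^(dim M), in the charts at [x].
   Two covectors at [x] are equal iff these families are equal. *)
Definition mderivative f x (e : chart R M (dim M)) (v : 'rV[R]_(dim M)) : R :=
  if `[< chart_at x e >]
  then 'd (f \o chart_inv e : 'rV[R]_(dim M) -> R) (e x) v
  else 0.

End manifold_derivative.

Notation borel T := (g_sigma_algebraType (@open T)).

Definition supp (R : realType) (T : ptopologicalType)
    (P : probability (borel T) R) : set T :=
  [set x | forall U : set T, open U -> U x -> (0 < P U)%E].

Definition nonatomic d (T : measurableType d) (R : realType)
    (P : probability T R) : Prop :=
  forall A, measurable A -> (0 < P A)%E ->
    exists B, [/\ measurable B, B `<=` A & (0 < P B < P A)%E].

Section transport.
Variables (R : realType) (n : nat) (X : 'I_n.+1 -> smooth_manifold R).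

Definition tailX : Type := forall j : 'I_n, X (lift ord0 j).

HB.instance Definition _ := Pointed.copy tailX
  (forall j : 'I_n, X (lift ord0 j)).
HB.instance Definition _ := Topological.copy tailX
  (prod_topology (fun j : 'I_n => X (lift ord0 j))).

(* X_1 x ... x X_(n+1), arranged as X_1 x (X_2 x ... x X_(n+1)). *)
Definition prodX : Type := (X ord0 * tailX)%type.

HB.instance Definition _ := Pointed.copy prodX (X ord0 * tailX)%type.
HB.instance Definition _ := Topological.copy prodX (X ord0 * tailX)%type.

Variable mu : forall i : 'I_n.+1, probability (borel (X i)) R.

Definition transport_plan (P : probability (borel prodX) R) : Prop :=
  (forall A : set (borel (X ord0)), measurable A ->
     pushforward P (fun z : borel prodX => z.1 : borel (X ord0)) A
     = mu ord0 A) /\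
  (forall (j : 'I_n) (A : set (borel (X (lift ord0 j)))), measurable A ->
     pushforward P (fun z : borel prodX => z.2 j : borel (X (lift ord0 j))) A
     = mu (lift ord0 j) A).

Definition box (A : forall i, set (X i)) : set prodX :=
  [set z | A ord0 z.1 /\ forall j, A (lift ord0 j) (z.2 j)].

(* This determines [P]: the spaces being second countable, the boxes generate
   the Borel sets of the product. *)
Definition is_product_measure (P : probability (borel prodX) R) : Prop :=
  forall A : (forall i, set (borel (X i))), (forall i, measurable (A i)) ->
    P (box A) = (\prod_(i < n.+1) mu i (A i))%E.

Variable c : prodX -> R.

Definition dsum (u : forall i, X i -> R) (z : prodX) : R :=
  u ord0 z.1 + \sum_(j < n) u (lift ord0 j) (z.2 j).

Definition cost (P : probability (borel prodX) R) : \bar R :=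
  (\int[P]_z (c z)%:E)%E.

Definition optimal_plan (P : probability (borel prodX) R) : Prop :=
  transport_plan P /\ forall Q, transport_plan Q -> (cost P <= cost Q)%E.

Definition slice1 (y : tailX) : X ord0 -> R := fun x => c (x, y).

Definition D1 : set prodX := [set z | mdifferentiable (slice1 z.2) z.1].

Definition Dx1 (z : prodX) := mderivative (slice1 z.2) z.1.

Definition c_splitting (S : set prodX) : Prop :=
  exists u : forall i, X i -> R,
    [/\ forall i, measurable_fun [set: borel (X i)] (u i),
        forall z, dsum u z <= c z
      & forall z, S z -> dsum u z = c z].

Definition m_twisted (m : nat) : Prop :=
  forall S, c_splitting S -> forall xbar, (S `&` D1) xbar ->
    [set z | [/\ (S `&` D1) z, z.1 = xbar.1 & Dx1 xbar = Dx1 z]] #<= `I_m.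

Definition dual_solution (phi : forall i, X i -> R) : Prop :=
  [/\ forall i, measurable_fun [set: borel (X i)] (phi i),
      forall i, (mu i).-integrable [set: borel (X i)] (EFin \o phi i),
      {ae mu ord0, forall x, mdifferentiable (phi ord0) x},
      forall z, dsum phi z <= c z
    & forall P, optimal_plan P ->
        cost P = (\sum_(i < n.+1) \int[mu i]_x (phi i x)%:E)%E].

Record standing_assumptions : Prop := StandingAssumptions {
  cost_ge0 : forall z, 0 <= c z ;
  cost_lsc : lower_semicontinuous (EFin \o c) ;
  cost_D1_ae : exists2 P : probability (borel prodX) R,
    is_product_measure P & {ae P, forall z, D1 z} ;
  cost_finite : exists2 P, transport_plan P & cost P \is a fin_num ;
  cost_dual : exists phi, dual_solution phi
}.

(* gamma = \sum_i alpha_i (Id x G_i)_# mu_1, tested against C_b. *)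
Definition graph_decomposition (gamma : probability (borel prodX) R) (k : nat)
    (alpha : 'I_k -> X ord0 -> R) (G : 'I_k -> X ord0 -> tailX) : Prop :=
  forall f : prodX -> R, continuous f -> bounded_fun f ->
    (\int[gamma]_z (f z)%:E =
     \sum_(i < k) \int[mu ord0]_x (alpha i x * f (x, G i x))%:E)%E.

End transport.

(* Main.v *)
Require Import Defs.
From HB Require Import structures.
From mathcomp Require Import all_boot all_order all_algebra.
From mathcomp Require Import all_classical all_reals all_analysis.
From mathcomp Require Import measurable_realfun.

Set Implicit Arguments.
Unset Strict Implicit.
Unset Printing Implicit Defensive.

Import Order.TTheory GRing.Theory Num.Theory.
Import numFieldNormedType.Exports.

Local Open Scope classical_set_scope.
Local Open Scope ring_scope.

(** Let [phi] solve the dual problem. An optimal plan [gamma] has the same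
cost as [phi], and [dsum phi <= c], so [gamma] is carried by the contact set
where [dsum phi = c] ([optimal_plan_contact]); this is a c-splitting set. At a
contact point [(x, y)] the function [c (_, y)] minus [phi ord0] is minimal at
[x], so that if both are differentiable there then the derivative of [c] in
its first variable is that of [phi ord0] at [x] ([mderivative_contact]), which
does not depend on [y]. By the twist condition, [gamma] is thus carried by a
Borel set whose sections above the points of [X ord0] have at most [m] points.

Such a measure is carried by [m] graphs. Manifolds are second countable and
locally compact, so [gamma] is inner regular and the Borel set can be shrunk
to a sigma-compact set [C] of full measure ([sigma_compact_exhaustion]). Now
for every open [U] the set of the [x] whose section of [C] meets [U] is the
projection of a sigma-compact set, hence Borel. This is what is needed to
select one point in every non-empty section in a Borel way: around a point of
a finite section there is a member of a countable base that contains no other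
point of the section, and the first such member to work is used
([measurable_selection]). Removing the selected points and repeating yields
Borel maps [G 0, ..., G m.-1] whose graphs cover [C] ([finite_selection]).

Finally, cut [gamma] into its restrictions to these graphs, made disjoint. The
image of each restriction on [X ord0] is dominated by the first marginal, and
its density is the coefficient [alpha i]; the densities add up to one because
the images add up to the marginal ([section_decomposition]). *)

(** * Sigma-compact sets *)

(** A countable union of compact sets. *)
Definition sigma_compact (T : topologicalType) (A : set T) : Prop :=
  exists2 K : nat -> set T, (forall k, compact (K k)) & A = \bigcup_k K k.

(** Every neighbourhood of a point contains a compact neighbourhood of it. *)
Definition compactly_based (T : topologicalType) : Prop :=
  forall (x : T) (U : set T), open U -> U x ->
    exists K, [/\ compact K, nbhs x K & K `<=` U].

(** A countable base, enumerated by the natural numbers. *)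
Definition enum_base (T : topologicalType) (B : nat -> set T) : Prop :=
  (forall k, open (B k)) /\
  (forall U x, open U -> U x -> exists2 k, B k x & B k `<=` U).

Lemma second_countable_enum_base (T : topologicalType) :
  @second_countable T -> exists B, @enum_base T B.
Proof.
move=> [F /pcard_surjP[g gF] [Fo Fb]].
exists (fun k => if `[< F (g k) >] then g k else set0).
split=> [k|U x oU Ux]; first by case: asboolP => [/Fo//|_]; exact: open0.
have [V /= [FV Vx] VU] : filter_from [set V | F V /\ V x] id U.
  by apply: Fb; exact: open_nbhs_nbhs.
have [k _ gkV] := gF _ FV; exists k; rewrite gkV; case: asboolP => //.
Qed.

Lemma countable_enum_base (T : topologicalType) (I : countType)
    (F : I -> set T) :
  (forall i, open (F i)) ->
  (forall U x, open U -> U x -> exists2 i, F i x & F i `<=` U) ->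
  exists B, @enum_base T B.
Proof.
move=> Fo Fb; exists (fun k => if unpickle k is Some i then F i else set0).
split=> [k|U x oU Ux].
  by case: unpickle => [i|]; [exact: Fo|exact: open0].
by have [i Fix FiU] := Fb _ _ oU Ux; exists (pickle i); rewrite pickleK.
Qed.

Lemma enum_base_sep (T : topologicalType) (B : nat -> set T) (x y : T) :
  hausdorff_space T -> enum_base B -> x <> y -> exists2 k, B k x & ~ B k y.
Proof.
move=> T2 [_ Bb] xy.
have oy : open (~` [set y]).
  by rewrite openC; exact: accessible_closed_set1 (hausdorff_accessible T2) _.
by have [k Bx BU] := Bb _ _ oy xy; exists k => // /BU; apply.
Qed.

Lemma sigma_compact_bigcup (T : topologicalType) (A : nat -> set T) :
  (forall k, sigma_compact (A k)) -> sigma_compact (\bigcup_k A k).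
Proof.
move=> cA; pose K k := sval (cid2 (cA k)).
have cK k l : compact (K k l) by rewrite /K; case: cid2.
have AK k : A k = \bigcup_l K k l by rewrite /K; case: cid2.
exists (fun n => if unpickle n is Some (k, l) then K k l else set0) => [n|].
  by case: unpickle => [[k l]//|]; exact: compact0.
apply/seteqP; split=> [x [k _]|x [n _]].
  by rewrite AK => -[l _ Klx]; exists (pickle (k, l)); rewrite ?pickleK.
by case: unpickle => [[k l] Kx|//]; exists k => //; rewrite AK; exists l.
Qed.

Lemma sigma_compact_closedI (T : topologicalType) (A F : set T) :
  sigma_compact A -> closed F -> sigma_compact (A `&` F).
Proof.
move=> [K cK ->] cF; exists (fun k => K k `&` F); last by rewrite setI_bigcupl.
by move=> k; exact: compact_closedI.
Qed.

Lemma sigma_compactI (T : topologicalType) (A C : set T) : hausdorff_space T ->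
  sigma_compact A -> sigma_compact C -> sigma_compact (A `&` C).
Proof.
move=> T2 cA [K cK ->]; rewrite setI_bigcupr; apply: sigma_compact_bigcup => k.
by apply: sigma_compact_closedI => //; exact: compact_closed.
Qed.

Lemma sigma_compact_image (T U : topologicalType) (f : T -> U) (A : set T) :
  continuous f -> sigma_compact A -> sigma_compact (f @` A).
Proof.
move=> cf [K cK ->]; exists (fun k => f @` K k); last by rewrite image_bigcup.
move=> k; apply: continuous_compact => //.
exact: continuous_subspaceT.
Qed.

Lemma open_sigma_compact (T : topologicalType) (B : nat -> set T) (U : set T) :
  enum_base B -> compactly_based T -> open U -> sigma_compact U.
Proof.
move=> [_ Bb] cb oU.
(* [K k] is some compact set between [B k] and [U], or empty if there is none *)
pose P k K := [/\ compact K, B k `<=` K & K `<=` U].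
pose K k := if pselect (exists K, P k K) is left e then sval (cid e) else set0.
exists K => [k|].
  rewrite /K; case: pselect => [e|_]; first by case: (cid e) => ? [].
  exact: compact0.
apply/seteqP; split=> [x Ux|x [k _]]; last first.
  by rewrite /K; case: pselect => [e|//]; case: (cid e) => L /= [_ _]; exact.
have [L [cL nL LU]] := cb _ _ oU Ux.
move: nL; rewrite nbhsE => -[V [oV Vx] VL].
have [k Bx BV] := Bb _ _ oV Vx.
exists k => //; rewrite /K; case: pselect => [e|ne].
  by case: (cid e) => M /= [_ BM _]; exact: BM.
by exfalso; apply: ne; exists L; split=> //; exact: subset_trans VL.
Qed.

(** * Products *)

Lemma setX_open (S T : topologicalType) (A : set S) (C : set T) :
  open A -> open C -> open (A `*` C).
Proof.
move=> oA oC; rewrite openE => -[x y] [/= Ax Cy].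
by exists (A, C) => //; split; exact: open_nbhs_nbhs.
Qed.

Lemma open_setX (S T : topologicalType) (U : set (S * T)) (z : S * T) :
  open U -> U z ->
  exists A C, [/\ open A, open C, A z.1, C z.2 & A `*` C `<=` U].
Proof.
rewrite openE => oU /oU [[A C] /= []]; rewrite !nbhsE.
move=> [A' [oA' A'z] A'A] [C' [oC' C'z] C'C] ACU; exists A', C'; split => //.
by move=> u [/= /A'A ? /C'C ?]; exact: ACU.
Qed.

Lemma prod_enum_base (S T : topologicalType) (A : nat -> set S)
    (B : nat -> set T) : enum_base A -> enum_base B ->
  exists C : nat -> set (S * T), enum_base C.
Proof.
move=> [oA bA] [oB bB].
apply: (@countable_enum_base _ (nat * nat)%type
  (fun p => A p.1 `*` B p.2)) => [p|U z oU Uz]; first exact: setX_open.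
have [V [W [oV oW Vz Wz VWU]]] := open_setX oU Uz.
have [k Akz AkV] := bA _ _ oV Vz; have [l Blz BlW] := bB _ _ oW Wz.
by exists (k, l) => // u [/= /AkV ? /BlW ?]; exact: VWU.
Qed.

Lemma prod_compactly_based (S T : topologicalType) :
  compactly_based S -> compactly_based T -> compactly_based (S * T)%type.
Proof.
move=> cS cT z U oU Uz.
have [V [W [oV oW Vz Wz VWU]]] := open_setX oU Uz.
have [K [cK nK KV]] := cS _ _ oV Vz; have [L [cL nL LW]] := cT _ _ oW Wz.
exists (K `*` L); split; first exact: compact_setX.
  by exists (K, L).
by move=> u [/= /KV ? /LW ?]; exact: VWU.
Qed.

Lemma prod_hausdorff (S T : topologicalType) :
  hausdorff_space S -> hausdorff_space T -> hausdorff_space (S * T)%type.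
Proof.
move=> S2 T2 [x y] [x' y'] c.
have n1 (a : S) (b : T) A : nbhs a A -> nbhs (a, b) (fst @^-1` A).
  by move=> nA; exists (A, setT) => [|? []//]; split=> //; exact: filterT.
have n2 (a : S) (b : T) C : nbhs b C -> nbhs (a, b) (snd @^-1` C).
  by move=> nC; exists (setT, C) => [|? []//]; split=> //; exact: filterT.
congr pair; [apply: S2|apply: T2] => A C nA nC.
  by have [[u v] [Au Cu]] := c _ _ (n1 _ y _ nA) (n1 _ y' _ nC); exists u.
by have [[u v] [Au Cu]] := c _ _ (n2 x _ _ nA) (n2 x' _ _ nC); exists v.
Qed.

(** * Borel maps *)

Lemma measurable_fun_open d (X : measurableType d) (Y : ptopologicalType)
    (f : X -> Y) : (forall U, open U -> measurable (f @^-1` U)) ->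
  measurable_fun [set: X] (f : X -> borel Y).
Proof.
move=> mf; apply: (@measurability _ _ X (borel Y) _ f (@open Y)) => //.
by move=> _ [U oU <-]; rewrite setTI; exact: mf.
Qed.

Lemma continuous_borel (S T : ptopologicalType) (f : S -> T) : continuous f ->
  measurable_fun [set: borel S] (f : borel S -> borel T).
Proof.
move=> /continuousP cf; apply: measurable_fun_open => U oU.
by apply: sub_sigma_algebra; exact: cf.
Qed.

Lemma continuous_borel_real (R : realType) (T : ptopologicalType) (f : T -> R) :
  continuous f -> measurable_fun [set: borel T] (f : borel T -> R).
Proof.
move=> /continuousP cf.
apply: (measurability _ (RGenOpens.measurableE R)) => _ [_ [a [b ->]] <-].
by rewrite setTI; apply: sub_sigma_algebra; apply: cf; exact: itv_open.
Qed.

Lemma lower_semicontinuous_borel (R : realType) (T : ptopologicalType)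
    (f : T -> \bar R) : lower_semicontinuous f ->
  measurable_fun [set: borel T] (f : borel T -> \bar R).
Proof.
move=> /lower_semicontinuousP lf.
apply: (measurability _ (ErealGenOInfty.measurableE R)).
move=> _ [_ [a ->]] <-; rewrite setTI preimage_itvoy.
by apply: sub_sigma_algebra; exact: lf.
Qed.

Lemma sigma_compact_measurable (T : ptopologicalType) (A : set T) :
  hausdorff_space T -> sigma_compact A -> measurable (A : set (borel T)).
Proof.
move=> T2 [K cK ->]; apply: bigcupT_measurable => k.
rewrite -[K k]setCK; apply: measurableC; apply: sub_sigma_algebra.
by rewrite openC; exact: compact_closed.
Qed.

Lemma measurable_eq_borel d (W : measurableType d) (T : ptopologicalType)
    (B : nat -> set T) (f g : W -> T) :
  hausdorff_space T -> enum_base B ->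
  measurable_fun [set: W] (f : W -> borel T) ->
  measurable_fun [set: W] (g : W -> borel T) ->
  measurable [set w | f w = g w].
Proof.
move=> T2 bB mf mg.
rewrite (_ : [set _ | _] = ~` \bigcup_k (f @^-1` B k `\` g @^-1` B k)).
  apply: measurableC; apply: bigcupT_measurable => k.
  apply: measurableD; rewrite -[X in measurable X]setTI;
    [apply: mf|apply: mg] => //; apply: sub_sigma_algebra; exact: bB.1.
apply/seteqP; split=> w /=; first by move=> fg [k _ [/=]]; rewrite fg.
apply: contra_notP => fg; have [k Bf nB] := enum_base_sep T2 bB fg.
by exists k.
Qed.

(** * Inner regularity *)

Section inner_regularity.
Context (R : realType) (T : ptopologicalType) (P : probability (borel T) R).
Local Open Scope ereal_scope.

Let closed_measurable (F : set T) : closed F -> measurable (F : set (borel T)).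
Proof.
move=> cF; rewrite -(setCK F); apply: measurableC.
by apply: sub_sigma_algebra; rewrite openC.
Qed.

(** [A] can be approximated in measure by closed subsets. *)
Definition inner_closed (A : set (borel T)) : Prop :=
  forall e : R, (0 < e)%R ->
    exists F : set T, [/\ closed F, F `<=` A & P (A `\` F) < e%:E].

Let closed_inner_closed (F : set T) : closed F -> inner_closed F.
Proof.
by move=> cF e e0; exists F; split=> //; rewrite setDv measure0 lte_fin.
Qed.

(* continuity from above of [P] along the tails of a countable union *)
Let trunc_measure (E : nat -> set (borel T)) (e : R) :
  (forall k, measurable (E k)) -> (0 < e)%R ->
  exists n, P (\bigcup_k E k `\` \bigcup_(k < n) E k) < e%:E.
Proof.
move=> mE e0; pose D n : set (borel T) := \bigcup_k E k `\` \bigcup_(k < n) E k.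
have mD n : measurable (D n).
  apply: measurableD; first exact: bigcupT_measurable.
  by apply: bigcup_measurable => k _; exact: mE.
have D0 : \bigcap_n D n = set0.
  rewrite -subset0 => x Dx; have [[k _ Ekx] _] := Dx 0%N I.
  by have [_] := Dx k.+1 I; apply; exists k => /=.
have : P \o D @ \oo --> P (\bigcap_n D n).
  apply: nonincreasing_cvg_mu => //.
  - by apply: le_lt_trans (probability_le1 P (mD 0%N)) _; rewrite ltry.
  - by rewrite D0; exact: measurable0.
  - apply/nonincreasing_seqP => n; apply/subsetPset; apply: setDS.
    by apply: bigcup_sub => k kn; apply: bigcup_sup => /=; exact: ltnW.
rewrite D0 measure0 => /fine_cvgP[_ /cvgrPdist_lt/(_ e e0)].
move=> [n _ /(_ n (leqnn _))].
rewrite sub0r normrN /= => nD; exists n.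
rewrite -[X in X < _](fineK (fin_num_measure P _ (mD n))) lte_fin.
exact: le_lt_trans (ler_norm _) nD.
Qed.

Let approx_seq (A : nat -> set (borel T)) (e : R) : (0 < e)%R ->
  (forall k, measurable (A k)) -> (forall k, inner_closed (A k)) ->
  exists F : nat -> set T, [/\ forall k, closed (F k), forall k, F k `<=` A k &
    forall X : set (borel T), measurable X -> X `<=` \bigcup_k (A k `\` F k) ->
      P X <= e%:E].
Proof.
move=> e0 mA iA.
have ek0 k : (0 < e / (2 ^ k.+1)%:R)%R by rewrite divr_gt0// ltr0n expn_gt0.
have /choice[F /all_and3[cF FA PF]] := fun k => iA k _ (ek0 k).
exists F; split=> // X mX XAF.
apply: le_trans (measure_sigma_subadditive P _ mX XAF) _.
  by move=> k; apply: measurableD => //; exact: closed_measurable.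
apply: le_trans (epsilon_trick0 xpredT (ltW e0)).
by apply: lee_nneseries => [k _ _|k _]; [exact: measure_ge0|exact/ltW/PF].
Qed.

Let bigcup_inner_closed (A : nat -> set (borel T)) :
  (forall k, measurable (A k)) -> (forall k, inner_closed (A k)) ->
  inner_closed (\bigcup_k A k).
Proof.
move=> mA iA e e0; have e20 : (0 < e / 2)%R by rewrite divr_gt0.
have [F [cF FA PF]] := approx_seq e20 mA iA.
have mF k : measurable (F k : set (borel T)) by exact: closed_measurable.
have [n Pn] := trunc_measure mF e20.
have mFn : measurable (\bigcup_(k < n) F k : set (borel T)).
  by apply: bigcup_measurable => k _; exact: mF.
have mUF : measurable (\bigcup_k F k : set (borel T)).
  exact: bigcupT_measurable.
have mUA : measurable (\bigcup_k A k) by exact: bigcupT_measurable.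
exists (\bigcup_(k < n) F k); split.
- by apply: closed_bigcup => //; exact: finite_II.
- by move=> x [k _ /FA Akx]; exists k.
have mD1 : measurable (\bigcup_k A k `\` \bigcup_k F k : set (borel T)).
  exact: measurableD.
have mD2 : measurable (\bigcup_k F k `\` \bigcup_(k < n) F k : set (borel T)).
  exact: measurableD.
apply: (@le_lt_trans _ _ (P (\bigcup_k A k `\` \bigcup_k F k) +
    P (\bigcup_k F k `\` \bigcup_(k < n) F k))).
  apply: le_trans (measureU2 P mD1 mD2); rewrite le_measure ?inE//.
  - exact: measurableD.
  - exact: measurableU.
  - move=> x [UAx nF]; have [UFx|nUF] := pselect ((\bigcup_k F k) x).
      by right.
    by left.
rewrite [e]splitr EFinD lee_ltD//; first exact: fin_num_measure.
apply: PF => //.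
by move=> x [[k _ Akx] nF]; exists k => //; split=> // Fkx; apply: nF; exists k.
Qed.

Let bigcap_inner_closed (A : nat -> set (borel T)) :
  (forall k, measurable (A k)) -> (forall k, inner_closed (A k)) ->
  inner_closed (\bigcap_k A k).
Proof.
move=> mA iA e e0; have e20 : (0 < e / 2)%R by rewrite divr_gt0.
have [F [cF FA PF]] := approx_seq e20 mA iA.
have cUF : closed (\bigcap_k F k) by apply: closed_bigI => k _; exact: cF.
exists (\bigcap_k F k); split=> //.
  by move=> x Fx k _; exact/FA/Fx.
apply: (@le_lt_trans _ _ (e / 2)%:E); last first.
  by rewrite lte_fin ltr_pdivrMr// ltr_pMr// ltr1n.
apply: PF.
  by apply: measurableD; [exact: bigcapT_measurable|exact: closed_measurable].
move=> x [Ax /existsNP[k /not_implyP[_ nFk]]]; exists k => //; split=> //.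
exact: Ax.
Qed.

Hypothesis T2 : hausdorff_space T.
Hypothesis opens_sigma_compact : forall U : set T, open U -> sigma_compact U.

(** The sets that are approximated from inside together with their complement
form a sigma-algebra. It contains the open sets, which are countable unions of
closed ones. *)
Lemma measurable_inner_closed (A : set (borel T)) :
  measurable A -> inner_closed A.
Proof.
pose reg (A : set (borel T)) :=
  [/\ measurable A, inner_closed A & inner_closed (~` A)].
suff: measurable `<=` reg by move=> sub /sub[].
apply: smallest_sub.
  split.
  - split; first exact: measurable0.
      by apply: closed_inner_closed; exact: closed0.
    by rewrite setC0; apply: closed_inner_closed; exact: closedT.
  - move=> B [mB iB iCB]; rewrite setTD; split => //; first exact: measurableC.
    by rewrite setCK.
  - move=> B /all_and3[mB iB iCB]; split.
    + exact: bigcupT_measurable.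
    + exact: bigcup_inner_closed.
    + rewrite setC_bigcup; apply: bigcap_inner_closed => // k.
      exact: measurableC.
move=> U oU; split.
- exact: sub_sigma_algebra.
- have [K cK ->] := opens_sigma_compact oU.
  have clK k : closed (K k) by exact: compact_closed.
  apply: bigcup_inner_closed => k; first exact: closed_measurable.
  exact: closed_inner_closed.
- by apply: closed_inner_closed; rewrite closedC.
Qed.

(** Exhausting [A] up to a null set by a countable union of closed subsets;
these are themselves sigma-compact, the whole space being so. *)
Lemma sigma_compact_exhaustion (A : set (borel T)) : measurable A ->
  exists C : set T, [/\ sigma_compact C, C `<=` A,
    measurable (C : set (borel T)) & P (A `\` C) = 0].
Proof.
move=> mA; have iA := measurable_inner_closed mA.
have n0 n : (0 < n.+1%:R^-1 :> R)%R by rewrite invr_gt0 ltr0n.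
have /choice[F /all_and3[cF FA PF]] := fun n => iA _ (n0 n).
have mF k : measurable (F k : set (borel T)) by exact: closed_measurable.
have mUF : measurable (\bigcup_k F k : set (borel T)).
  exact: bigcupT_measurable.
exists (\bigcup_k F k); split => //.
- apply: sigma_compact_bigcup => k; rewrite -[F k]setTI.
  apply: sigma_compact_closedI => //.
  by apply: opens_sigma_compact; exact: openT.
- by move=> x [k _ /FA].
apply/eqP; rewrite eq_le measure_ge0 andbT; apply/lee_addgt0Pr => e e0.
rewrite add0e.
have [n _ /(_ n (leqnn _)) ne] := near_infty_natSinv_lt (PosNum e0).
apply: (@le_trans _ _ (P (A `\` F n))).
  rewrite le_measure ?inE//; [exact: measurableD|exact: measurableD|].
  by apply: setDS; exact: bigcup_sup.
by apply: (le_trans (ltW (PF n))); rewrite lee_fin ltW.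
Qed.

End inner_regularity.

(** * Measurable selection of finite sections *)

Lemma card_le_seq (T : pointedType) (A : set T) (m : nat) :
  (A #<= `I_m)%card -> exists2 s : seq T, (size s <= m)%N & A `<=` [set` s].
Proof.
move=> /pcard_surjP[g gA]; exists [seq g i | i <- iota 0 m].
  by rewrite size_map size_iota.
move=> x /gA[i /= im <-]; apply: map_f; by rewrite mem_iota.
Qed.

Section selection.
Context d (X : measurableType d) (Y : ptopologicalType) (B : nat -> set Y).
Hypotheses (bB : enum_base B) (Y2 : hausdorff_space Y).

(** A map [T : X -> set Y] stands for the subset of [X * Y] with sections [T x].
[hit T U] is the set of the points whose section meets [U]. *)
Definition hit (T : X -> set Y) (U : set Y) : set X :=
  [set x | T x `&` U !=set0].

(** Effros measurability of a set-valued map. *)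
Definition hit_measurable (T : X -> set Y) : Prop :=
  forall U : set Y, open U -> measurable (hit T U).

Let oB k : open (B k). Proof. by case: bB. Qed.

(** The points whose section has exactly one element in [B k]: the section meets
[B k], but it meets no two disjoint pieces of it. *)
Let single (T : X -> set Y) (k : nat) : set X :=
  hit T (B k) `\` \bigcup_i \bigcup_(j in [set j | B i `&` B j = set0])
    (hit T (B k `&` B i) `&` hit T (B k `&` B j)).

Let single_measurable T k : hit_measurable T -> measurable (single T k).
Proof.
move=> mT; apply: measurableD; first exact: mT.
apply: bigcupT_measurable => i; apply: bigcup_measurable => j _.
by apply: measurableI; apply: mT; exact: openI.
Qed.

Let single_uniq T k x y y' : single T k x ->
  (T x `&` B k) y -> (T x `&` B k) y' -> y = y'.
Proof.
move=> [_ nxk] [Ty By] [Ty' By']; apply: contrapT => /eqP yy'; apply: nxk.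
move: Y2; rewrite open_hausdorff => /(_ _ _ yy')[[U V] /= [yU y'V] [oU oV UV]].
rewrite !inE in yU y'V.
have [i Bi iU] := bB.2 _ _ oU yU; have [j Bj jV] := bB.2 _ _ oV y'V.
exists i => //; exists j => /=.
  rewrite -subset0 => z [/iU Uz /jV Vz].
  by have : (U `&` V) z by []; rewrite (eqP UV).
by split; [exists y|exists y'].
Qed.

Let single_cover T x : finite_set (T x) -> T x !=set0 ->
  exists k, single T k x.
Proof.
move=> fT [y Ty].
have oU : open (~` (T x `\ y)).
  rewrite openC.
  move/accessible_finite_set_closed: (hausdorff_accessible Y2) => cf.
  by apply: cf; exact: finite_setD.
have [k Bky BkU] : exists2 k, B k y & B k `<=` ~` (T x `\ y).
  by apply: bB.2 => // -[_]; exact.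
have Tk z : T x z -> B k z -> z = y.
  by move=> Tz /BkU nz; apply: contrapT => zy; apply: nz.
exists k; split; first by exists y.
move=> [i _ [j /= ij0 [[z [Tz [/(Tk _ Tz) zy Bi]]]]]].
move=> [w [Tw [/(Tk _ Tw) wy Bj]]].
move: ij0; rewrite -subset0 => /(_ y); apply.
by split; [rewrite -zy|rewrite -wy].
Qed.

(** At [x] the selected point is the only element of the section in [B k],
for the least [k] such that [single T k x]; such a [k] exists because a finite
set in a Hausdorff space is discrete. *)
Lemma measurable_selection (T : X -> set Y) :
  hit_measurable T -> (forall x, finite_set (T x)) ->
  exists G : X -> Y, measurable_fun [set: X] (G : X -> borel Y) /\
    forall x, T x !=set0 -> T x (G x).
Proof.
move=> mT fT; pose D := seqDU (single T).
have mS k : measurable (single T k) by exact: single_measurable.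
have mD k : measurable (D k).
  by apply: measurableD => //; exact: bigsetU_measurable.
have DS k x : D k x -> single T k x by move=> [].
have DU x : (exists k, single T k x) -> exists k, D k x.
  move=> [k Skx].
  have : (\bigcup_k D k) x by rewrite -seqDU_bigcup_eq; exists k.
  by move=> [l _ Dl]; exists l.
have /choice[G GP] : forall x, exists y,
    (forall k, D k x -> (T x `&` B k) y) /\ ((forall k, ~ D k x) -> y = point).
  move=> x; have [[k Dk]|nD] := pselect (exists k, D k x).
    have [[y [Ty By]] _] := DS _ _ Dk; exists y; split; last by move=> /(_ k).
    move=> l Dl; suff -> : l = k by [].
    by have := @trivIset_seqDU _ (single T) l k I I; apply; exists x.
  by exists point; split=> // k Dk; exfalso; apply: nD; exists k.
exists G; split; last first.
  move=> x /(single_cover (fT x))/DU[k Dk].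
  by have [/(_ _ Dk)[]] := GP x.
apply: measurable_fun_open => U oU.
rewrite (_ : G @^-1` U = \bigcup_k (D k `&` hit T (B k `&` U)) `|`
    (~` (\bigcup_k D k) `&` [set x | U point])).
  apply: measurableU.
    apply: bigcupT_measurable => k; apply: measurableI => //.
    by apply: mT; exact: openI.
  apply: measurableI; first exact/measurableC/bigcupT_measurable.
  have [Up|nUp] := pselect (U point).
    by rewrite (_ : [set _ | _] = setT) //; apply/seteqP; split.
  by rewrite (_ : [set _ | _] = set0) //; apply/seteqP; split.
apply/seteqP; split=> x /=.
  move=> UGx; have [[k Dk]|nD] := pselect (exists k, D k x); last first.
    right; split; first by move=> [k _ Dk]; apply: nD; exists k.
    rewrite -(proj2 (GP x))// => k Dk; apply: nD; by exists k.
  left; exists k => //; split=> //; exists (G x).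
  by have [/(_ _ Dk)[]] := GP x.
move=> [[k _ [Dk [y [Ty [By Uy]]]]]|[nD Up]].
  have [/(_ _ Dk) GB _] := GP x.
  by rewrite (single_uniq (DS _ _ Dk) GB (conj Ty By)).
by rewrite (proj2 (GP x))// => k Dk; apply: nD; exists k.
Qed.

(* [U] meets the section minus [G x] iff some [B k] that avoids [G x] meets the
section inside [U] *)
Let hit_measurable_setD1 (T : X -> set Y) (G : X -> Y) :
  hit_measurable T -> measurable_fun [set: X] (G : X -> borel Y) ->
  hit_measurable (fun x => T x `\ G x).
Proof.
move=> mT mG U oU.
rewrite (_ : hit _ U = \bigcup_k (~` (G @^-1` B k) `&` hit T (U `&` B k))).
  apply: bigcupT_measurable => k; apply: measurableI; last first.
    by apply: mT; exact: openI.
  apply: measurableC; rewrite -[X in measurable X]setTI; apply: mG => //.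
  exact: sub_sigma_algebra.
apply/seteqP; split=> x /=.
  move=> [y [[Ty yG] Uy]]; have [k By nB] := enum_base_sep Y2 bB yG.
  by exists k => //; split=> //; exists y.
move=> [k _ [nB [y [Ty [Uy By]]]]]; exists y; split=> //; split=> // yG.
by apply: nB; rewrite /= -yG.
Qed.

(** A set-valued map with sections of at most [m] points is covered by the
graphs of [m] measurable maps: select one point of each section, remove it, and
repeat. *)
Lemma finite_selection (m : nat) (T : X -> set Y) : hit_measurable T ->
  (forall x, exists2 s : seq Y, (size s <= m)%N & T x `<=` [set` s]) ->
  exists G : nat -> X -> Y,
    (forall i, measurable_fun [set: X] (G i : X -> borel Y)) /\
    forall x y, T x y -> exists2 i, (i < m)%N & y = G i x.
Proof.
elim: m T => [|m IH] T mT sT.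
  exists (fun=> cst point); split=> [?|x y Ty]; first exact: measurable_cst.
  by have [s] := sT x; rewrite leqn0 size_eq0 => /eqP-> /(_ _ Ty).
have fT x : finite_set (T x).
  by have [s _ Ts] := sT x; exact: sub_finite_set Ts (finite_seq s).
have [G0 [mG0 TG0]] := measurable_selection mT fT.
have [|x|G [mG TG]] := IH (fun x => T x `\ G0 x).
- exact: hit_measurable_setD1.
- have [s sm Ts] := sT x.
  have [Tx0|/set0P/TG0 TG0x] := eqVneq (T x) set0.
    by exists [::] => // y []; rewrite Tx0.
  exists (rem (G0 x) s).
    by rewrite size_rem ?(Ts _ TG0x)// -subn1 leq_subLR add1n.
  move=> y [/Ts/= ys /eqP yG]; have := perm_to_rem (Ts _ TG0x).
  by move=> /perm_mem/(_ y); rewrite ys inE (negbTE yG).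
exists (fun i => if i is j.+1 then G j else G0); split; first by case.
move=> x y Ty; have [->|yG] := pselect (y = G0 x); first by exists 0%N.
by have [i im ->] := TG x y (conj Ty yG); exists i.+1.
Qed.

End selection.

(** * Measures carried by finitely many graphs *)

Section image_of_restriction.
Context d d' (Z : measurableType d) (X : measurableType d') (R : realType).
Variables (gamma : {finite_measure set Z -> \bar R}) (D : set Z) (p : Z -> X).
Hypotheses (mD : measurable D) (mp : measurable_fun [set: Z] p).
Local Open Scope ereal_scope.

(** The image under [p] of the restriction of [gamma] to [D]. *)
Definition image_restr (mE : measurable D) & measurable_fun [set: Z] p :=
  pushforward (mrestr gamma mE) p.

Local Notation nu := (image_restr mD mp).

Let nu0 : nu set0 = 0.
Proof. by rewrite /image_restr /pushforward preimage_set0 measure0. Qed.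

Let nu_ge0 A : 0 <= nu A.
Proof. exact: measure_ge0. Qed.

Let nu_sigma_additive : semi_sigma_additive nu.
Proof.
exact: (@measure_semi_sigma_additive _ _ _ (pushforward (mrestr gamma mD) p)).
Qed.

HB.instance Definition _ :=
  isMeasure.Build _ _ _ nu nu0 nu_ge0 nu_sigma_additive.

Let nu_fin : fin_num_fun nu.
Proof.
move=> A mA; apply: fin_num_measure.
by rewrite -[X in measurable X]setTI; exact: mp.
Qed.

HB.instance Definition _ := Measure_isFinite.Build _ _ _ nu nu_fin.

Lemma integral_image_restr (h : X -> \bar R) : measurable_fun [set: X] h ->
  gamma.-integrable [set: Z] (h \o p) ->
  nu.-integrable [set: X] h /\ \int[nu]_x h x = \int[gamma]_(z in D) h (p z).
Proof.
move=> mh ih.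
have DC0 : mrestr gamma mD (~` D) = 0 by rewrite /mrestr setICl measure0.
have rE (f : Z -> \bar R) : (mrestr gamma mD).-integrable [set: Z] f ->
    \int[mrestr gamma mD]_z f z = \int[gamma]_(z in D) f z.
  move=> fi; rewrite (negligible_integral (measurableC mD) measurableT fi DC0).
  rewrite setTD setCK; apply: eq_measure_integral => A mA AD.
  by rewrite /= /mrestr setIidl.
have ihr : (mrestr gamma mD).-integrable [set: Z] (h \o p).
  apply/integrableP; split; first exact: measurableT_comp.
  move/integrableP : ih => [mhp]; apply: le_lt_trans.
  apply: ge0_le_measure_integral => // [A mA|]; last exact: measurableT_comp.
  by apply: le_measure; rewrite ?inE//; exact: measurableI.
split; first exact: integrable_pushforward.
by rewrite integral_pushforward// rE.
Qed.

End image_of_restriction.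

(** If [gamma], with image [mu] under [p], is carried by the ranges of finitely
many measurable sections [g i] of [p], then it is a combination of the images of
[mu] under these sections. The range of [g i] is the set where [g i \o p] is the
identity; making the ranges disjoint, the coefficient of [g i] is the density of
the image of what [gamma] puts there. *)
Lemma section_decomposition d d' (Z : measurableType d) (X : measurableType d')
    (R : realType) (gamma : probability Z R) (mu : probability X R)
    (p : Z -> X) (g : nat -> X -> Z) (m : nat) :
  measurable_fun [set: Z] p ->
  (forall i, measurable_fun [set: X] (g i)) ->
  (forall i, measurable [set z | g i (p z) = z]) ->
  (forall i x, p (g i x) = x) ->
  gamma (~` \big[setU/set0]_(i < m) [set z | g i (p z) = z]) = 0%E ->
  (forall A, measurable A -> gamma (p @^-1` A) = mu A) ->
  exists alpha : nat -> X -> R,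
  [/\ forall i, measurable_fun [set: X] (alpha i) /\ (forall x, 0 <= alpha i x),
      forall f : Z -> R, measurable_fun [set: Z] f -> bounded_fun f ->
        (\int[gamma]_z (f z)%:E =
         \sum_(i < m) \int[mu]_x (alpha i x * f (g i x))%:E)%E
    & {ae mu, forall x, \sum_(i < m) alpha i x = 1}].
Proof.
move=> mp mg mgr pg grN pmu.
pose gr i := [set z | g i (p z) = z]; pose D := seqDU gr.
have mD i : measurable (D i).
  apply: measurableD; first exact: mgr.
  by apply: bigsetU_measurable => j _; exact: mgr.
have mpre A : measurable A -> measurable (p @^-1` A).
  by move=> mA; rewrite -[X in measurable X]setTI; exact: mp.
pose nu i : {finite_measure set X -> \bar R} := image_restr gamma (mD i) mp.
have numu i : nu i `<< mu.
  apply/null_content_dominatesP => A mA muA0; apply/eqP.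
  have gA0 : gamma (p @^-1` A) = 0%E by rewrite pmu.
  rewrite eq_le measure_ge0 andbT -gA0.
  apply: le_measure; rewrite ?inE.
  - by apply: measurableI => //; exact: mpre.
  - exact: mpre.
  - exact: subIsetl.
pose rho i := Radon_Nikodym_SigmaFinite.f (nu i) mu.
have rho0 i x : (0 <= rho i x)%E by exact: Radon_Nikodym_SigmaFinite.f_ge0.
have rhof i x : rho i x \is a fin_num.
  exact: Radon_Nikodym_SigmaFinite.f_fin_num.
have irho i : mu.-integrable [set: X] (rho i).
  exact: Radon_Nikodym_SigmaFinite.f_integrable.
have mrho i : measurable_fun [set: X] (rho i) := measurable_int _ (irho i).
have rhoE i (h : X -> \bar R) : (nu i).-integrable [set: X] h ->
    (\int[mu]_x (h x * rho i x) = \int[nu i]_x h x)%E.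
  move=> ih.
  rewrite -(Radon_Nikodym_change_of_variables (numu i) measurableT ih).
  have mh := measurable_int _ ih.
  apply: ae_eq_integral => //; first exact: emeasurable_funM.
    have numu' : charge_of_finite_measure (nu i) `<< mu := numu i.
    exact: emeasurable_funM.
  have := ae_eq_Radon_Nikodym_SigmaFinite (numu i) measurableT.
  by apply: filterS => x /= + xT => /(_ xT) <-.
pose alpha i x := fine (rho i x).
have malpha i : measurable_fun [set: X] (alpha i) by exact: measurableT_comp.
have bint dd (W : measurableType dd) (P : probability W R) (f : W -> R) :
    measurable_fun [set: W] f -> bounded_fun f ->
    P.-integrable [set: W] (EFin \o f).
  move=> mf bf; apply: measurable_bounded_integrable => //.
  by apply: le_lt_trans (probability_le1 P measurableT) _; rewrite ltry.
have bcomp (W W' : Type) (f : W' -> R) (h : W -> W') : bounded_fun f ->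
    bounded_fun (f \o h).
  by move=> [M [Mr fM]]; exists M; split=> // r Mr' w _; exact: fM.
have decomp (f : Z -> R) : measurable_fun [set: Z] f -> bounded_fun f ->
    (\int[gamma]_z (f z)%:E =
     \sum_(i < m) \int[mu]_x (alpha i x * f (g i x))%:E)%E.
  move=> mf bf; have fi := bint _ _ gamma _ mf bf.
  have mU : measurable (\big[setU/set0]_(i < m) gr i).
    by apply: bigsetU_measurable => i _; exact: mgr.
  rewrite (negligible_integral (measurableC mU) measurableT fi grN).
  rewrite setTD setCK integral_mkcond.
  transitivity (\int[gamma]_z \sum_(i < m) ((EFin \o f) \_ (D i)) z)%E.
    apply: eq_integral => z _.
    rewrite patchE; case: ifPn => [|/negP]; rewrite inE.
      rewrite (bigsetU_seqDU gr m) -(bigcup_mkord m D) => -[k /= km Dk].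
      rewrite (bigD1 (Ordinal km))//= patchE mem_set// big1 ?adde0// => j jk.
      rewrite patchE memNset// => Dj; move/eqP: jk; apply; apply: val_inj => /=.
      by apply: (@trivIset_seqDU _ gr) => //; exists z.
    rewrite -(bigcup_mkord m gr) => nz; rewrite big1// => j _.
    by rewrite patchE memNset// => -[gj _]; apply: nz; exists j => /=.
  rewrite integral_sum//; last first.
    move=> i; apply: (integrable_mkcond _ (mD i)).1.
    exact: (integrableS measurableT (mD i) (@subsetT _ _) fi).
  apply: eq_bigr => i _; rewrite -integral_mkcond.
  have mfg : measurable_fun [set: X] (EFin \o (f \o g i)).
    by apply/measurable_EFinP; exact: measurableT_comp.
  have [|inu nuE] := @integral_image_restr _ _ _ _ _ gamma _ _ (mD i) mp _ mfg.
    apply: (bint _ _ gamma ((f \o g i) \o p)); last exact/bcomp/bcomp.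
    by apply: measurableT_comp => //; exact: measurableT_comp.
  (* on [D i] the point [z] is [g i (p z)] *)
  transitivity (\int[gamma]_(z in D i) (EFin \o (f \o g i)) (p z))%E.
    by apply: eq_integral => z; rewrite inE /= => -[/= -> _].
  rewrite -nuE -rhoE//; apply: eq_integral => x _ /=.
  by rewrite muleC EFinM fineK.
exists alpha; split=> //.
  by move=> i; split=> // x; exact: fine_ge0.
have ialpha i : mu.-integrable [set: X] (EFin \o alpha i).
  apply: eq_integrable (irho i) => // x _; exact: esym (fineK (rhof i x)).
pose S x := (\sum_(i < m) (alpha i x)%:E)%E.
have iS : mu.-integrable [set: X] S.
  by apply: integrable_sum => // i _; exact: ialpha.
(* test the decomposition against the indicators of the cylinders [p @^-1` A] *)
have : ae_eq mu [set: X] S (cst 1%E).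
  apply: integral_ae_eq => // A _ mA.
  have bI : bounded_fun (\1_(p @^-1` A) : Z -> R).
    exists 1; split=> // r r1 z _; rewrite /= indicE ger0_norm//.
    by rewrite (le_trans _ (ltW r1))// lern1 leq_b1.
  have := decomp _ (measurable_indic (mpre _ mA)) bI.
  rewrite integral_indic// ?setIT; last exact: mpre.
  move=> gE; rewrite integral_cst// mul1e.
  transitivity (gamma (p @^-1` A)); last exact: pmu.
  rewrite [RHS]gE.
  rewrite integral_sum//; last by move=> i; exact: integrableS (ialpha i).
  apply: eq_bigr => i _; rewrite integral_mkcond; apply: eq_integral => x _.
  rewrite patchE indicE (_ : (g i x \in _) = (x \in A)); last first.
    by apply/idP/idP; rewrite !inE /= pg.
  by case: ifPn => _; rewrite /= ?mulr1 ?mulr0.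
by apply: filterS => x /(_ I) /=; rewrite /S sumEFin => -[].
Qed.

(** * Finite products and manifolds *)

Section finite_product.
Context (I : finType) (K : I -> topologicalType).
Local Notation T := (prod_topology K).

Lemma prod_coord_continuous (i : I) : continuous ((fun f => f i) : T -> K i).
Proof. exact: proj_continuous. Qed.

Lemma prod_box_open (A : forall i, set (K i)) : (forall i, open (A i)) ->
  open [set f : T | forall i, A i (f i)].
Proof.
move=> oA; rewrite openE => f Af.
have nA i : nbhs f [set g : T | A i (g i)].
  exact: (@prod_coord_continuous i f _ (open_nbhs_nbhs (conj (oA i) (Af i)))).
exact: (@filter_forall _ _ (fun i => [set g : T | A i (g i)])
  (nbhs (f : T)) _ nA).
Qed.

Lemma prod_open_box (U : set T) (f : T) : open U -> U f ->
  exists A : forall i, set (K i),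
    [/\ forall i, open (A i), forall i, A i (f i) &
    [set g : T | forall i, A i (g i)] `<=` U].
Proof.
move=> oU Uf.
(* the filter generated by the open boxes around [f] converges to [f] *)
pose F := filter_from
  [set A : forall i, set (K i) | forall i, open (A i) /\ A i (f i)]
  (fun A => [set g : T | forall i, A i (g i)]).
have FF : Filter F.
  apply: filter_from_filter.
    by exists (fun=> setT) => i; split=> //; exact: openT.
  move=> A B oA oB; exists (fun i => A i `&` B i) => [i|g ABg].
    have [? ?] := oA i; have [? ?] := oB i; split; last by [].
    exact: openI.
  by split=> i; have [] := ABg i.
have : F --> f.
  apply/cvg_sup => i W; rewrite nbhsE => -[_ [[V oV <-] /= Vf] VW].
  exists (fun j =>
    if pselect (i = j) is left e then ecast j (set (K j)) e V else setT).
    move=> j /=; case: pselect => [e|_]; last by split=> //; exact: openT.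
    by case: j / e.
  move=> g /(_ i); case: pselect => // e; rewrite (Prop_irrelevance e erefl)/=.
  exact: VW.
move=> /(_ U (open_nbhs_nbhs (conj oU Uf)))[A /= oA AU].
by exists A; split=> // i; have [] := oA i.
Qed.

Lemma fin_prod_enum_base (B : forall i, nat -> set (K i)) :
  (forall i, enum_base (B i)) -> exists C : nat -> set T, enum_base C.
Proof.
move=> bB; apply: (@countable_enum_base _ {ffun I -> nat}
  (fun k => [set f : T | forall i, B i (k i) (f i)])).
  by move=> k; exact: (prod_box_open (fun i => (bB i).1 (k i))).
move=> U f oU Uf; have [A [oA Af AU]] := prod_open_box oU Uf.
have /choice[k kP] : forall i, exists k, B i k (f i) /\ B i k `<=` A i.
  by move=> i; have [k ? ?] := (bB i).2 _ _ (oA i) (Af i); exists k.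
exists (finfun k) => [i|g Bg]; first by rewrite ffunE; case: (kP i).
by apply: AU => i; have := Bg i; rewrite ffunE; case: (kP i) => _; exact.
Qed.

Lemma fin_prod_compactly_based :
  (forall i, compactly_based (K i)) -> compactly_based T.
Proof.
move=> cK f U oU Uf; have [A [oA Af AU]] := prod_open_box oU Uf.
pose L i := sval (cid (cK i _ _ (oA i) (Af i))).
have LP i : [/\ compact (L i), nbhs (f i) (L i) & L i `<=` A i].
  by rewrite /L; case: cid.
exists [set g : T | forall i, L i (g i)]; split.
- by apply: tychonoff => i; case: (LP i).
- have nL i : nbhs f [set g : T | L i (g i)].
    by have [_ nL _] := LP i; exact: (@prod_coord_continuous i f _ nL).
  exact: (@filter_forall _ _ (fun i => [set g : T | L i (g i)]) (nbhs f) _ nL).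
- by move=> g Lg; apply: AU => i; case: (LP i) => _ _; apply; exact: Lg.
Qed.

End finite_product.

Lemma closed_ball_compact (R : realType) (d : nat) (a : 'rV[R]_d) (r : R) :
  0 < r -> compact (closed_ball a r).
Proof.
move=> r0; apply: bounded_closed_compact; last exact: closed_ball_closed.
exists (`|a| + r); split=> [|M ltM x]; first exact: num_real.
rewrite closed_ballE// /closed_ball_ /= => xr; apply: le_trans (ltW ltM).
by rewrite -[x](subrK a) addrC (le_trans (ler_normD _ _))// lerD2l distrC.
Qed.

(** The images of small closed balls by the inverse of a chart. *)
Lemma manifold_compactly_based (R : realType) (M : smooth_manifold R) :
  compactly_based M.
Proof.
move=> x U oU Ux.
have [e Ae dx] : (\bigcup_(e in atlas (s := M)) chart_dom e) x.
  by rewrite atlas_cover.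
have [r rV] : exists r : {posnum R}, closed_ball (e x) r%:num `<=`
    (e @` chart_dom e) `&` chart_inv e @^-1` U.
  apply/nbhs_closedballP; apply: filterI.
    by apply: open_nbhs_nbhs; split; [exact: chart_cod_open|exists x].
  apply: chart_inv_continuous; first by rewrite inE; exists x.
  by rewrite chart_mapK ?inE//; exact: open_nbhs_nbhs.
exists (chart_inv e @` closed_ball (e x) r%:num); split.
- apply: continuous_compact; last exact: closed_ball_compact.
  apply: continuous_in_subspaceT => v; rewrite inE => /rV[ev _].
  by apply: chart_inv_continuous; rewrite inE.
- have : nbhs x (chart_dom e `&` e @^-1` closed_ball (e x) r%:num).
    apply: filterI.
      by apply: open_nbhs_nbhs; split=> //; exact: chart_dom_open.
    apply: chart_map_continuous; first by rewrite inE.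
    by apply/nbhs_closedballP; exists r.
  apply: filterS => y [dy ry]; exists (e y) => //.
  by rewrite chart_mapK// inE.
- by move=> _ [v /rV[_ Uv] <-].
Qed.

(** * First-order condition on the contact set *)

Lemma diff_at_min (R : realType) (d : nat) (f : 'rV[R]_d -> R) (a : 'rV[R]_d) :
  differentiable f a -> (forall b, f a <= f b) -> forall v, 'd f a v = 0.
Proof.
move=> df fmin.
have ge0 v : 0 <= 'd f a v.
  rewrite -deriveE//; have dv : derivable f a v by exact: diff_derivable.
  rewrite /derive cvg_at_rightE//; apply: limr_ge.
    by apply: cvgP; apply: cvg_dnbhs_at_right; exact: dv.
  near=> h; apply: mulr_ge0; last by rewrite subr_ge0; exact: fmin.
  by rewrite invr_ge0 ltW.
move=> v; apply/eqP; rewrite eq_le ge0 andbT.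
by rewrite -oppr_ge0 -linearN.
Unshelve. all: by end_near. Qed.

(** If [g] lies above a translate of [f] and touches it at [x], then in any
chart their difference has a global minimum at [x]. *)
Lemma mderivative_contact (R : realType) (M : smooth_manifold R) (f g : M -> R)
    (b : R) (x : M) : mdifferentiable f x -> mdifferentiable g x ->
  (forall y, f y + b <= g y) -> f x + b = g x ->
  mderivative g x = mderivative f x.
Proof.
move=> df dg fg fgx; apply/funext => e; apply/funext => v; rewrite /mderivative.
case: asboolP => [ex|_]; last by [].
have dF := df _ ex; have dG := dg _ ex.
have xE : chart_inv e (e x) = x by rewrite chart_mapK// inE; case: ex.
have := diff_at_min (differentiableB dG dF).
rewrite (diffB dG dF) => /(_ _ v)/eqP; rewrite subr_eq0 => H.
apply/eqP/H => w; rewrite !fctE /= xE -fgx addrAC subrr add0r.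
by rewrite lerBrDr addrC.
Qed.

(** * The support *)

Section support.
Context (R : realType) (T : ptopologicalType) (P : probability (borel T) R).

Lemma supp_setC_open : open (~` supp P).
Proof.
rewrite openE => x /existsNP[U /not_implyP[oU /not_implyP[Ux PU]]].
rewrite /interior nbhsE; exists U => // y Uy /(_ _ oU Uy); exact: PU.
Qed.

Lemma supp_measurable : measurable (supp P : set (borel T)).
Proof.
rewrite -(setCK (supp P)); apply: measurableC; apply: sub_sigma_algebra.
exact: supp_setC_open.
Qed.

Lemma supp_full (B : nat -> set T) : enum_base B -> P (~` supp P) = 0%E.
Proof.
move=> [oB bB].
(* the complement of the support is the union of the null sets of the base *)
pose N k : set (borel T) := if P (B k) == 0%E then B k else set0.
have mN k : measurable (N k).
  by rewrite /N; case: ifPn => _ //; apply: sub_sigma_algebra; exact: oB.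
have PN : P.-negligible (\bigcup_k N k).
  apply: negligible_bigcup => k; apply/negligibleP => //.
  by rewrite /N; case: ifPn => [/eqP//|_]; rewrite measure0.
have mS : measurable (~` supp P : set (borel T)).
  by apply: measurableC; exact: supp_measurable.
apply/(negligibleP _ mS); apply: negligibleS PN.
move=> x /existsNP[U /not_implyP[oU /not_implyP[Ux PU]]].
have [k Bx BU] := bB _ _ oU Ux; exists k => //.
rewrite /N; case: ifPn => // /eqP; apply.
apply/eqP; rewrite eq_le measure_ge0 andbT leNgt; apply/negP => Bk; apply: PU.
apply: (lt_le_trans Bk); apply: le_measure => //; rewrite inE.
  by apply: sub_sigma_algebra; exact: oB.
exact: sub_sigma_algebra.
Qed.

End support.

(** Integration against a measure with a prescribed image. *)
Lemma integrable_marginal d d' (Z : measurableType d) (X : measurableType d')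
    (R : realType) (gamma : {measure set Z -> \bar R})
    (mu : {measure set X -> \bar R}) (p : Z -> X) (f : X -> \bar R) :
  measurable_fun [set: Z] p ->
  (forall A, measurable A -> pushforward gamma p A = mu A) ->
  mu.-integrable [set: X] f ->
  gamma.-integrable [set: Z] (f \o p) /\
  (\int[gamma]_z f (p z) = \int[mu]_x f x)%E.
Proof.
move=> mp pmu fi; have mf := measurable_int _ fi.
have fpi : gamma.-integrable [set: Z] (f \o p).
  apply/integrableP; split; first exact: measurableT_comp.
  move/integrableP : fi => [_]; apply: le_lt_trans.
  rewrite le_eqVlt; apply/orP; left; apply/eqP.
  transitivity (\int[pushforward gamma p]_x `|f x|)%E.
    by rewrite (ge0_integral_pushforward mp)//; exact: measurableT_comp.
  by apply: eq_measure_integral => A mA _; exact: pmu.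
split=> //; rewrite -(@integral_pushforward _ _ _ _ _ _ mp gamma setT f)//.
by apply: eq_measure_integral => A mA _; exact: pmu.
Qed.

(** * The transport problem *)

Section transport_spaces.
Context (R : realType) (n : nat) (X : 'I_n.+1 -> smooth_manifold R).
Let K (j : 'I_n) : topologicalType := X (lift ord0 j).

Lemma tailX_enum_base : exists B : nat -> set (tailX X), enum_base B.
Proof.
have bX j : exists B : nat -> set (K j), enum_base B.
  apply: second_countable_enum_base.
  exact: (manifold_second_countable (X (lift ord0 j))).
exact: (@fin_prod_enum_base _ K (fun j => sval (cid (bX j)))
  (fun j => svalP (cid (bX j)))).
Qed.

Lemma tailX_hausdorff : hausdorff_space (tailX X).
Proof.
apply: (@hausdorff_product _ K) => j; exact: manifold_hausdorff.
Qed.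

Lemma tailX_compactly_based : compactly_based (tailX X).
Proof.
by apply: (@fin_prod_compactly_based _ K) => j; exact: manifold_compactly_based.
Qed.

Lemma prodX_enum_base : exists B : nat -> set (prodX X), enum_base B.
Proof.
have [B bB] := tailX_enum_base.
have [A bA] := second_countable_enum_base (manifold_second_countable (X ord0)).
exact: prod_enum_base bA bB.
Qed.

Lemma prodX_hausdorff : hausdorff_space (prodX X).
Proof.
apply: prod_hausdorff; [exact: manifold_hausdorff|exact: tailX_hausdorff].
Qed.

Lemma prodX_compactly_based : compactly_based (prodX X).
Proof.
apply: prod_compactly_based; first exact: manifold_compactly_based.
exact: tailX_compactly_based.
Qed.

Lemma fstX_continuous : continuous (fst : prodX X -> X ord0).
Proof. by move=> z; exact: cvg_fst. Qed.

Lemma sndX_continuous : continuous (snd : prodX X -> tailX X).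
Proof. by move=> z; exact: cvg_snd. Qed.

Lemma coordX_continuous (j : 'I_n) :
  continuous ((fun z => z.2 j) : prodX X -> X (lift ord0 j)).
Proof.
move=> z; apply: (@continuous_comp _ _ _ (snd : prodX X -> tailX X)
  ((fun y : tailX X => y j) : tailX X -> K j)); first exact: sndX_continuous.
exact: (@prod_coord_continuous _ K j).
Qed.

End transport_spaces.

Lemma measurable_pair_borel d (W : measurableType d) (R : realType) (n : nat)
    (X : 'I_n.+1 -> smooth_manifold R) (f : W -> X ord0) (g : W -> tailX X)
    (A : nat -> set (X ord0)) (B : nat -> set (tailX X)) :
  enum_base A -> enum_base B ->
  measurable_fun [set: W] (f : W -> borel (X ord0)) ->
  measurable_fun [set: W] (g : W -> borel (tailX X)) ->
  measurable_fun [set: W] ((fun w => (f w, g w)) : W -> borel (prodX X)).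
Proof.
move=> bA bB mf mg; apply: measurable_fun_open => U oU.
rewrite (_ : _ @^-1` U = \bigcup_k \bigcup_(l in [set l | A k `*` B l `<=` U])
    (f @^-1` A k `&` g @^-1` B l)).
  apply: bigcupT_measurable => k; apply: bigcup_measurable => l _.
  apply: measurableI; rewrite -[X in measurable X]setTI;
    [apply: mf|apply: mg] => //; apply: sub_sigma_algebra;
    [exact: bA.1|exact: bB.1].
apply/seteqP; split=> w /=.
  move=> Ufg; have [V [V' [oV oV' /= Vf Vg VU]]] := open_setX oU Ufg.
  have [k Ak AV] := bA.2 _ _ oV Vf; have [l Bl BV] := bB.2 _ _ oV' Vg.
  by exists k => //; exists l => //= -[x y] /= [/AV Vx /BV Vy]; exact: VU.
by move=> [k _ [l /= ABU [Af Bg]]]; exact: ABU.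
Qed.

Section contact.
Context (R : realType) (n : nat) (X : 'I_n.+1 -> smooth_manifold R)
  (mu : forall i : 'I_n.+1, probability (borel (X i)) R) (c : prodX X -> R)
  (phi : forall i, X i -> R) (gamma : probability (borel (prodX X)) R).
Arguments phi : clear implicits.
Hypotheses (Hc : standing_assumptions mu c) (Hphi : dual_solution mu c phi)
  (Hgamma : optimal_plan mu c gamma).

Let mX0 : measurable_fun [set: borel (prodX X)]
  (fst : borel (prodX X) -> borel (X ord0)).
Proof. exact: continuous_borel (@fstX_continuous _ _ X). Qed.

Let mXj (j : 'I_n) : measurable_fun [set: borel (prodX X)]
  ((fun z => z.2 j) : borel (prodX X) -> borel (X (lift ord0 j))).
Proof. exact: continuous_borel (@coordX_continuous _ _ X j). Qed.

Lemma cost_measurable :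
  measurable_fun [set: borel (prodX X)] (c : borel (prodX X) -> R).
Proof.
by apply/measurable_EFinP; exact: lower_semicontinuous_borel (cost_lsc Hc).
Qed.

Lemma dsum_measurable :
  measurable_fun [set: borel (prodX X)] (dsum phi : borel (prodX X) -> R).
Proof.
have [mphi _ _ _ _] := Hphi.
apply: measurable_funD.
  exact: (measurableT_comp (mphi ord0) mX0).
apply: measurable_sum => j.
exact: (measurableT_comp (mphi (lift ord0 j)) (@mXj j)).
Qed.

Lemma noncontact_measurable :
  measurable [set z : borel (prodX X) | dsum phi z != c z].
Proof.
have mh : measurable_fun [set: borel (prodX X)] (fun z => c z - dsum phi z).
  by apply: measurable_funB; [exact: cost_measurable|exact: dsum_measurable].
rewrite (_ : [set _ | _] = ~` ((fun z => c z - dsum phi z) @^-1` [set 0])).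
  by apply: measurableC; rewrite -[X in measurable X]setTI; exact: mh.
apply/seteqP; split=> z /=.
  by move=> /eqP zc /eqP; rewrite subr_eq0 => /eqP/esym.
by move=> zc; apply/eqP => E; apply: zc; rewrite E subrr.
Qed.

Let cost_integrable : gamma.-integrable [set: borel (prodX X)] (EFin \o c).
Proof.
apply/integrableP; split.
  by apply/measurable_EFinP; exact: cost_measurable.
have [P tP fP] := cost_finite Hc.
apply: (@le_lt_trans _ _ (cost c P)); last by rewrite ltey_eq fP.
apply: le_trans (proj2 Hgamma _ tP); rewrite /cost le_eqVlt; apply/orP; left.
apply/eqP/eq_integral => z _; rewrite /= ger0_norm//; exact: cost_ge0 Hc z.
Qed.

Let dsum_integral :
  gamma.-integrable [set: borel (prodX X)] (EFin \o dsum phi) /\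
  (\int[gamma]_z (dsum phi z)%:E = \int[gamma]_z (c z)%:E)%E.
Proof.
have [_ iphi _ _ cE] := Hphi; have [tg0 tgj] := proj1 Hgamma.
have [i0 E0] := integrable_marginal mX0 tg0 (iphi ord0).
have [ij Ej] : (forall j, gamma.-integrable [set: borel (prodX X)]
    (fun z => (phi (lift ord0 j) (z.2 j))%:E)) /\
    (forall j, \int[gamma]_z (phi (lift ord0 j) (z.2 j))%:E =
      \int[mu (lift ord0 j)]_x (phi (lift ord0 j) x)%:E)%E.
  split=> j;
    by have [] := integrable_marginal (@mXj j) (tgj j) (iphi (lift ord0 j)).
have dE : (EFin \o dsum phi : borel (prodX X) -> \bar R) =
    ((fun z => (phi ord0 z.1)%:E) \+
     (fun z => \sum_(j < n) (phi (lift ord0 j) (z.2 j))%:E))%E.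
  by apply/funext => z; rewrite /= /dsum EFinD sumEFin.
have iS : gamma.-integrable [set: borel (prodX X)]
    (fun z => \sum_(j < n) (phi (lift ord0 j) (z.2 j))%:E)%E.
  by apply: integrable_sum => // j _; exact: ij.
split; first by rewrite dE; exact: integrableD.
rewrite -[RHS]/(cost c gamma) (cE _ Hgamma) big_ord_recl.
transitivity (\int[gamma]_z ((phi ord0 z.1)%:E +
    \sum_(j < n) (phi (lift ord0 j) (z.2 j))%:E))%E.
  by apply: eq_integral => z _; rewrite /dsum EFinD sumEFin.
rewrite integralD//; congr (_ + _)%E; first exact: E0.
by rewrite integral_sum//; apply: eq_bigr => j _; exact: Ej.
Qed.

(** An optimal plan has the cost of the dual solution, so it is carried by the
set where the dual constraint is an equality. *)
Lemma optimal_plan_contact :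
  gamma [set z : borel (prodX X) | dsum phi z != c z] = 0%E.
Proof.
have [_ _ _ le_c _] := Hphi; have [id Ed] := dsum_integral.
pose h (z : borel (prodX X)) : R := c z - dsum phi z.
have mh : measurable_fun [set: borel (prodX X)] h.
  by apply: measurable_funB; [exact: cost_measurable|exact: dsum_measurable].
have h0 : (\int[gamma]_z `|(h z)%:E|)%E = 0%E.
  transitivity (\int[gamma]_z ((c z)%:E - (dsum phi z)%:E))%E.
    by apply: eq_integral => z _; rewrite gee0_abs ?EFinB// lee_fin subr_ge0.
  rewrite integralB// Ed subee//.
  exact: integrable_fin_num cost_integrable.
have mE := noncontact_measurable.
apply/(negligibleP _ mE).
have /ae_eq_integral_abs : measurable_fun [set: borel (prodX X)] (EFin \o h).
  exact/measurable_EFinP.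
move=> /(_ gamma measurableT)[/(_ h0) hz _].
apply: negligibleS hz => z /= zc H; move/eqP: zc; apply.
by have := H I => -[] /eqP; rewrite subr_eq0 => /eqP/esym.
Qed.

End contact.

Theorem theorem1p3 (R : realType) (n : nat) (X : 'I_n.+1 -> smooth_manifold R)
    (mu : forall i : 'I_n.+1, probability (borel (X i)) R)
    (c : prodX X -> R) (m : nat) :
  (1 <= m)%N ->
  standing_assumptions mu c ->
  m_twisted c m ->
  nonatomic (mu ord0) ->
  forall gamma : probability (borel (prodX X)) R,
    optimal_plan mu c gamma ->
    supp gamma `<=` D1 c ->
    exists (k : nat) (alpha : 'I_k -> X ord0 -> R)
        (G : 'I_k -> X ord0 -> tailX X),
      [/\ (1 <= k <= m)%N,
          forall i, measurable_fun [set: borel (X ord0)] (alpha i)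
            /\ (forall x, 0 <= alpha i x),
          forall i, measurable_fun [set: borel (X ord0)]
            (G i : borel (X ord0) -> borel (tailX X)),
          graph_decomposition mu gamma alpha G
        & {ae mu ord0, forall x, \sum_(i < k) alpha i x = 1}].
Proof.
move=> m1 Hc Htw _ gamma Hgamma suppD1.
have [phi Hphi] := cost_dual Hc.
have [mphi _ [N [mN N0 dN]] le_c _] := Hphi.
have [A bA] := second_countable_enum_base (manifold_second_countable (X ord0)).
have [B bB] := tailX_enum_base X.
have [E bE] := prodX_enum_base X.
have T2X : hausdorff_space (X ord0) by exact: manifold_hausdorff.
have T2Y := @tailX_hausdorff _ _ X; have T2Z := @prodX_hausdorff _ _ X.
have mfst : measurable_fun [set: borel (prodX X)]
    (fst : borel (prodX X) -> borel (X ord0)).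
  exact: continuous_borel (@fstX_continuous _ _ X).
have msnd : measurable_fun [set: borel (prodX X)]
    (snd : borel (prodX X) -> borel (tailX X)).
  exact: continuous_borel (@sndX_continuous _ _ X).
have opensZ (U : set (prodX X)) : open U -> sigma_compact U.
  by apply: open_sigma_compact bE _; exact: prodX_compactly_based.
pose S : set (prodX X) := [set z | dsum phi z = c z].
have splitS : c_splitting c S by exists phi; split.
(* the points off the contact set, off the support, or above a null set that
   contains all the points where [phi ord0] is not differentiable *)
pose bad : set (borel (prodX X)) :=
  ([set z | dsum phi z != c z] `|` ~` supp gamma) `|` fst @^-1` N.
have mbad : measurable bad.
  apply: measurableU; last by rewrite -[X in measurable X]setTI; exact: mfst.
  apply: measurableU; last by apply: measurableC; exact: supp_measurable.
  exact: noncontact_measurable Hc Hphi.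
have gbad : gamma.-negligible bad.
  apply: negligibleU.
    apply: negligibleU; apply/negligibleP.
    - exact: noncontact_measurable Hc Hphi.
    - exact: optimal_plan_contact Hc Hphi Hgamma.
    - by apply: measurableC; exact: supp_measurable.
    - exact: supp_full bE.
  apply/negligibleP; first by rewrite -[X in measurable X]setTI; exact: mfst.
  by rewrite -N0; exact: (proj1 (proj1 Hgamma)).
(* replacing the complement of [bad] by a sigma-compact subset of full measure
   makes the projections of its open pieces Borel *)
have [C [sC CA mC gC]] :=
  sigma_compact_exhaustion gamma T2Z opensZ (measurableC mbad).
have Cin z : C z -> [/\ S z, supp gamma z & ~ N z.1].
  move=> /CA nbad; split.
  - by apply: contrapT => nS; apply: nbad; left; left; apply/eqP.
  - by apply: contrapT => nS; apply: nbad; left; right.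
  - by move=> Nz; apply: nbad; right.
pose T (x : borel (X ord0)) : set (tailX X) := [set y | C (x, y)].
have hT : hit_measurable T.
  move=> U oU.
  rewrite (_ : hit T U = fst @` (C `&` snd @^-1` U)).
    apply: (@sigma_compact_measurable (X ord0)) => //.
    apply: (@sigma_compact_image (prodX X) (X ord0) fst).
      exact: fstX_continuous.
    apply: sigma_compactI => //; apply: opensZ.
    by apply: open_comp => // z _; exact: sndX_continuous.
  apply/seteqP; split=> x /=.
    by move=> [y [Ty Uy]]; exists (x, y).
  by move=> [[x' y] /= [Cxy Uy] <-]; exists y.
(* on [C] the derivative of the cost is that of [phi ord0], so it depends on the
   first coordinate only *)
have grad x y : C (x, y) ->
    D1 c (x, y) /\ Dx1 c (x, y) = mderivative (phi ord0) x.
  move=> Cz; have [Sz supz nN] := Cin _ Cz.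
  have Dz : D1 c (x, y) by exact: suppD1.
  split; first exact: Dz.
  pose b := \sum_(j < n) phi (lift ord0 j) (y j).
  apply: (@mderivative_contact _ _ (phi ord0) (slice1 c y) b).
  - by apply: contrapT => nd; apply: nN; exact: dN.
  - exact: Dz.
  - by move=> x'; exact: (le_c (x', y)).
  - exact: Sz.
have sT x : exists2 s : seq (tailX X), (size s <= m)%N & T x `<=` [set` s].
  have [Tx0|/set0P[y0 Ty0]] := eqVneq (T x) set0.
    by exists [::] => //; rewrite Tx0.
  have [D0 g0] := grad _ _ Ty0; have [S0 _ _] := Cin _ Ty0.
  have /card_le_seq[s sm Qs] := Htw S splitS (x, y0) (conj S0 D0).
  exists [seq z.2 | z <- s]; first by rewrite size_map.
  move=> y Ty; have [Dy gy] := grad _ _ Ty; have [Sy _ _] := Cin _ Ty.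
  apply/mapP; exists (x, y); last by [].
  apply: Qs; split; [exact: (conj Sy Dy)|exact: erefl|].
  rewrite g0 gy; reflexivity.
have [G [mG TG]] := finite_selection bB T2Y hT sT.
pose g i (x : borel (X ord0)) : borel (prodX X) := (x, G i x).
have mg i : measurable_fun [set: borel (X ord0)] (g i).
  exact: (measurable_pair_borel bA bB (@measurable_id _ _ _) (mG i)).
have mgr i : measurable [set z : borel (prodX X) | g i z.1 = z].
  rewrite (_ : [set _ | _] = [set z : borel (prodX X) | G i z.1 = z.2]).
    apply: (measurable_eq_borel T2Y bB) => //.
    exact: (measurableT_comp (mG i) mfst).
  by apply/seteqP; split=> -[x y] /=; [move=> []|move=> <-].
have cover : gamma (~` \big[setU/set0]_(i < m)
    [set z : borel (prodX X) | g i z.1 = z]) = 0%E.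
  have mgU : measurable (~` \big[setU/set0]_(i < m)
      [set z : borel (prodX X) | g i z.1 = z]).
    by apply: measurableC; apply: bigsetU_measurable => i _; exact: mgr.
  have gC' : gamma.-negligible (~` bad `\` C).
    by apply/negligibleP => //; apply: measurableD => //; exact: measurableC.
  apply/(negligibleP _ mgU); apply: negligibleS (negligibleU gbad gC').
  move=> z nz; have [zb|nzb] := pselect (bad z); [by left|right; split=> // Cz].
  apply: nz.
  rewrite -(bigcup_mkord m (fun i => [set z : borel (prodX X) | g i z.1 = z])).
  have [i im zi] : exists2 i, (i < m)%N & z.2 = G i z.1.
    by apply: TG; rewrite /T /= -surjective_pairing.
  by exists i => //=; rewrite /g -zi -surjective_pairing.
have [alpha [alphaP decomp sum1]] := section_decomposition mfst mg mgr
  (fun i x => erefl) cover (proj1 (proj1 Hgamma)).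
exists m, (fun i => alpha i), (fun i => G i); split=> //.
- by rewrite m1 leqnn.
- by move=> f cf bf; apply: decomp => //; exact: continuous_borel_real.
Qed.
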